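(* The following problem is undecidable: given a finite signature $\Sigma$ and a finite set $E$ of equations between $\Sigma$-terms, decide whether the monad $T$ on $\mathbf{Set}$ presented by $(\Sigma,E)$ is affine, i.e. whether $T1$ is a one-element set.
   Context: The monad presented by $(\Sigma,E)$ is the free-algebra monad: $TX$ is the carrier of the free $\Sigma$-algebra satisfying $E$ generated by $X$ (terms over $X$ modulo the congruence generated by substitution instances of $E$), $Tf$ substitutes $f(x)$ for $x$, $\eta$ sends a variable to itself, and $\mu$ flattens terms of terms. A monad is affine if $T1$ is terminal, i.e. a one-element set. *)

(* Defs.v *)
From Stdlib Require List.
From mathcomp Require Import all_boot.
Set Implicit Arguments. Unset Strict Implicit. Unset Printing Implicit Defensive.

(* A finite signature is a list of arities: symbol f (f < size sig) has
   arity nth 0 sig f. *)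
Definition signature := seq nat.

Inductive term : Type :=
| Var : nat -> term
| App : nat -> seq term -> term.

Fixpoint wf (sig : signature) (okv : nat -> bool) (t : term) : bool :=
  match t with
  | Var x => okv x
  | App f ts => [&& f < size sig, size ts == nth 0 sig f & all (wf sig okv) ts]
  end.

Fixpoint subst (s : nat -> term) (t : term) : term :=
  match t with
  | Var x => s x
  | App f ts => App f (map (subst s) ts)
  end.

Definition presentation := (signature * seq (term * term))%type.

Definition valid_presentation (p : presentation) : Prop :=
  forall l r, List.In (l, r) p.2 ->
    wf p.1 (fun _ => true) l /\ wf p.1 (fun _ => true) r.

(* The carrier of T('I_n) = free (Sigma,E)-algebra on n generators
   x_0..x_{n-1}: Sigma-terms over the variables 0..n-1 modulo the congruence
   generated by substitution instances of the equations of E.  [eqv p n] is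
   that congruence (on well-formed terms over n variables). *)
Inductive eqv (p : presentation) (n : nat) : term -> term -> Prop :=
| eqv_refl t : wf p.1 (fun x => x < n) t -> eqv p n t t
| eqv_sym t u : eqv p n t u -> eqv p n u t
| eqv_trans t u v : eqv p n t u -> eqv p n u v -> eqv p n t v
| eqv_cong f ts us :
    f < size p.1 -> size ts = nth 0 p.1 f -> size us = size ts ->
    (forall i, i < size ts -> eqv p n (nth (Var 0) ts i) (nth (Var 0) us i)) ->
    eqv p n (App f ts) (App f us)
| eqv_ax l r (s : nat -> term) :
    List.In (l, r) p.2 ->
    (forall x, wf p.1 (fun y => y < n) (s x)) ->
    eqv p n (subst s l) (subst s r).

(* The monad T presented by p is affine: T1 (well-formed terms over the
   single variable 0, modulo eqv p 1) is a one-element set. *)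
Definition affine (p : presentation) : Prop :=
  exists t, wf p.1 (fun x => x < 1) t /\
    forall u, wf p.1 (fun x => x < 1) u -> eqv p 1 t u.

(* Cantor pairing (a bijection nat * nat -> nat) *)
Definition cpair (a b : nat) : nat := ((a + b) * (a + b).+1)./2 + b.

Fixpoint enc_list (l : seq nat) : nat :=
  match l with
  | [::] => 0
  | x :: l' => (cpair x (enc_list l')).+1
  end.

Fixpoint enc_term (t : term) : nat :=
  match t with
  | Var x => cpair 0 x
  | App f ts => cpair 1 (cpair f (enc_list (map enc_term ts)))
  end.

Definition enc_presentation (p : presentation) : nat :=
  cpair (enc_list p.1)
        (enc_list (map (fun e => cpair (enc_term e.1) (enc_term e.2)) p.2)).

Inductive instr : Type :=
| Inc : nat -> instr
| Dec : nat -> nat -> instr.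

Definition program := seq instr.
Definition mstate := (nat * (nat -> nat))%type.   (* program counter, registers *)

Definition upd (R : nat -> nat) (r v : nat) : nat -> nat :=
  fun i => if i == r then v else R i.

(* one step; None = halted (program counter outside the program) *)
Definition step (P : program) (s : mstate) : option mstate :=
  match List.nth_error P s.1 with
  | None => None
  | Some (Inc r) => Some (s.1.+1, upd s.2 r (s.2 r).+1)
  | Some (Dec r j) =>
      if s.2 r == 0 then Some (j, s.2) else Some (s.1.+1, upd s.2 r (s.2 r).-1)
  end.

Fixpoint run (P : program) (k : nat) (s : mstate) : option mstate :=
  match step P s with
  | None => Some s
  | Some s' => match k with 0 => None | k'.+1 => run P k' s' end
  end.

Definition computes (P : program) (x y : nat) : Prop :=
  exists k s, run P k (0, fun r => if r == 0 then x else 0) = Some s /\ s.2 0 = y.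

Definition decidable_presentation_problem (Q : presentation -> Prop) : Prop :=
  exists P : program, forall p, valid_presentation p ->
    exists y, computes P (enc_presentation p) y /\ (y = 1 <-> Q p) /\ (y = 0 <-> ~ Q p).

(* Main.v *)
From Stdlib Require List.
From Stdlib Require Import FunctionalExtensionality PropExtensionality ClassicalEpsilon.
Require Import Defs.
From mathcomp Require Import all_boot.
From mathcomp Require Import zify.

Set Implicit Arguments. Unset Strict Implicit. Unset Printing Implicit Defensive.

(** Given a program [P] deciding affineness, we write a presentation whose
    equations simulate [P] on the code of that very presentation.  Equational
    logic is itself strong enough for the self-reference: the symbols [pr] and
    [quote] compute Cantor pairing and the code of a numeral, and the constant
    [self] is equated to the numeral coding all the other equations, so the code
    of the whole presentation is the value of a closed term [own_code] that does
    not depend on the value of [self].  The equation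
    [sel (exec P own_code) x y = y], where [sel 0 x y = x] and
    [sel (n + 1) x y = y], makes everything equal if [P] answers 0, whereas if
    [P] answers 1 it holds in the standard model on the natural numbers, which
    then separates 0 from 1. *)

(** * Semantics of terms *)

Fixpoint eval (I : nat -> seq nat -> nat) (v : nat -> nat) (t : term) : nat :=
  match t with
  | Var x => v x
  | App f ts => I f (map (eval I v) ts)
  end.

Lemma eval_subst I v s t :
  eval I v (subst s t) = eval I (fun x => eval I v (s x)) t.
Proof.
move: t; fix IH 1; case=> [x|f ts] //=; congr (I f _).
by elim: ts => //= t ts ->; rewrite IH.
Qed.

Lemma eqv_sound (p : presentation) I n t u :
    (forall l r v, List.In (l, r) p.2 -> eval I v l = eval I v r) ->
  eqv p n t u -> forall v, eval I v t = eval I v u.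
Proof.
move=> sat tu v; elim: tu => {t u} [//|t u _ ->//|t u w _ -> _ ->//| |].
- move=> f ts us _ _ eq_sz _ IH /=; congr (I f _).
  apply: (@eq_from_nth _ 0); rewrite !size_map // => i lt_i.
  by rewrite !(nth_map (Var 0)) ?eq_sz //; exact: IH.
- by move=> l r s lr _; rewrite !eval_subst; exact: sat.
Qed.

(** The [Forall2] form lets [constructor] handle congruence on the explicit argument lists used
    later. *)
Lemma eqv_app (p : presentation) n f ts us :
    f < size p.1 -> size ts = nth 0 p.1 f -> List.Forall2 (eqv p n) ts us ->
  eqv p n (App f ts) (App f us).
Proof.
move=> lt_f sz_ts ts_us.
suff [sz tsus] : size us = size ts /\
    forall i, i < size ts -> eqv p n (nth (Var 0) ts i) (nth (Var 0) us i).
  exact: eqv_cong.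
elim: ts_us {sz_ts} => [|t u {}ts {}us tu _ [sz IH]] //=.
by split=> [|[|i]]; [rewrite sz | | exact: IH].
Qed.

(** * Halting computations *)

Definition outputs (P : program) (s : mstate) (y : nat) : Prop :=
  exists k s', run P k s = Some s' /\ s'.2 0 = y.

Lemma outputs_step P s s' y :
  step P s = Some s' -> outputs P s y <-> outputs P s' y.
Proof.
move=> Ps; split=> [[[|k] [s2]]|[k [s2]]] /=.
- by rewrite Ps => -[].
- by rewrite Ps => run2; exists k, s2.
- by move=> run2; exists k.+1, s2; rewrite /= Ps.
Qed.

Lemma outputs_halt P s y : step P s = None -> outputs P s y <-> y = s.2 0.
Proof.
move=> Ps; split=> [[k [s2]]|->]; last by exists 0, s; rewrite /= Ps.
by case: k => [|k] /=; rewrite Ps => -[[<-]].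
Qed.

Lemma outputs_inj P s y z : outputs P s y -> outputs P s z -> y = z.
Proof.
move=> [k [s' [runk <-]]]; elim: k s runk => [|k IH] s /=;
  case Ps: (step P s) => [s2|] //.
- by move=> [<-] /(outputs_halt z Ps) ->.
- by move=> /IH out /(outputs_step z Ps).
- by move=> [<-] /(outputs_halt z Ps) ->.
Qed.

(* An unspecified number if the computation diverges. *)
Definition output (P : program) (s : mstate) : nat :=
  epsilon (inhabits 0) (outputs P s).

Lemma outputP P s y : outputs P s y -> output P s = y.
Proof.
move=> out; apply: (outputs_inj _ out).
by apply: epsilon_spec; exists y.
Qed.

(** The predicates [outputs P s] and [outputs P s'] are equal by extensionality, so [epsilon]
    chooses the same number even when the run diverges. Hence the model can satisfy the step
    equations at every configuration. *)
Lemma output_step P s s' : step P s = Some s' -> output P s = output P s'.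
Proof.
move=> Ps; congr (epsilon _ _); apply: functional_extensionality => y.
by apply: propositional_extensionality; exact: outputs_step.
Qed.

Lemma output_halt P s : step P s = None -> output P s = s.2 0.
Proof. by move=> Ps; apply/outputP/(outputs_halt _ Ps). Qed.

Definition instr_reg (i : instr) : nat :=
  match i with Inc r => r | Dec r _ => r end.

(** [P] touches no register from [nregs P] on, so an operation of finite arity can hold the machine
    state. The successor keeps register 0 among its arguments even for an empty program. *)
Definition nregs (P : program) : nat := (foldr maxn 0 (map instr_reg P)).+1.

Arguments nregs : simpl never.

Lemma instr_reg_lt P i ins :
  List.nth_error P i = Some ins -> instr_reg ins < nregs P.
Proof.
rewrite /nregs ltnS.
elim: P i => [|j P IH] [|i] //= => [[->]|/IH le_ins]; first exact: leq_maxl.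
by rewrite leq_max le_ins orbT.
Qed.

(** * The presentation *)

Definition zero := App 0 [::].
Definition succ t := App 1 [:: t].
Definition pr t u := App 2 [:: t; u].
Definition quote t := App 3 [:: t].
Definition sel t u v := App 4 [:: t; u; v].
Definition self := App 5 [::].
Definition exec K pc (regs : nat -> term) := App 6 (pc :: mkseq regs K).

Definition sig_of (P : program) : signature :=
  [:: 0; 1; 2; 1; 3; 0; (nregs P).+1].

(* Locked, because the numerals of codes must never be computed. *)
Definition num := locked (fun n => iter n succ zero).

Lemma numE n : num n = iter n succ zero.
Proof. by rewrite /num -lock. Qed.

Lemma num0 : num 0 = zero.
Proof. exact: numE. Qed.

Lemma numS n : num n.+1 = succ (num n).
Proof. by rewrite !numE. Qed.

(** Follows [enc_diagonal] with [pr] for [cpair]: [quote self] stands for the code of the numeral to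
    which [self] is equated, the final [self] for the code of the remaining equations. *)
Definition own_code (P : program) : term :=
  pr (num (enc_list (sig_of P)))
     (succ (pr (pr (num (enc_term self)) (quote self)) self)).

(* [Var r.+1] stands for the contents of register [r]; [Var 0] is free for the
   program counter. *)
Definition instr_equations K i (ins : instr) : seq (term * term) :=
  match ins with
  | Inc r =>
      [:: (exec K (num i) (fun q => Var q.+1),
           exec K (num i.+1)
             (fun q => if q == r then succ (Var q.+1) else Var q.+1))]
  | Dec r j =>
      [:: (exec K (num i) (fun q => if q == r then zero else Var q.+1),
           exec K (num j) (fun q => if q == r then zero else Var q.+1));
          (exec K (num i)
             (fun q => if q == r then succ (Var q.+1) else Var q.+1),
           exec K (num i.+1) (fun q => Var q.+1))]
  end.

(* The recursion for [pr] walks down the antidiagonals, the Cantor pairing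
   increasing by one at each step. *)
Definition base_equations (P : program) : seq (term * term) :=
  [:: (pr zero zero, zero);
      (pr (succ (Var 0)) zero, succ (pr zero (Var 0)));
      (pr (Var 0) (succ (Var 1)), succ (pr (succ (Var 0)) (Var 1)));
      (quote zero, num (enc_term zero));
      (quote (succ (Var 0)),
       pr (num 1) (pr (num 1) (succ (pr (quote (Var 0)) zero))));
      (sel zero (Var 0) (Var 1), Var 0);
      (sel (succ (Var 2)) (Var 0) (Var 1), Var 1);
      (exec (nregs P) (iter (size P) succ (Var 0)) (fun q => Var q.+1), Var 1);
      (sel (exec (nregs P) zero (fun q => if q == 0 then own_code P else zero))
           (Var 0) (Var 1), Var 1)].

Definition equations (P : program) : seq (term * term) :=
  base_equations P ++
  List.flat_map
    (fun i => if List.nth_error P i is Some ins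
              then instr_equations (nregs P) i ins else [::])
    (List.seq 0 (size P)).

Definition code (P : program) : nat :=
  enc_list (map (fun e => cpair (enc_term e.1) (enc_term e.2)) (equations P)).

(** The equation for [self] stays outside [equations P], so its right-hand side is defined without
    circularity. *)
Definition diagonal (P : program) : presentation :=
  (sig_of P, (self, num (code P)) :: equations P).

Lemma equations_instr P i ins e :
    List.nth_error P i = Some ins -> List.In e (instr_equations (nregs P) i ins) ->
  List.In e (equations P).
Proof.
move=> Pi in_e; apply: (List.in_or_app (base_equations P)); right; apply/List.in_flat_map.
exists i; rewrite Pi; split=> //; apply/List.in_seq; split; first exact/leP/leq0n.
by apply/List.nth_error_Some; rewrite Pi.
Qed.

Lemma diagonal_ind P (Q : term -> term -> Prop) :
    Q self (num (code P)) ->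
    (forall l r, List.In (l, r) (base_equations P) -> Q l r) ->
    (forall i ins l r, List.nth_error P i = Some ins ->
       List.In (l, r) (instr_equations (nregs P) i ins) -> Q l r) ->
  forall l r, List.In (l, r) (diagonal P).2 -> Q l r.
Proof.
move=> Qself Qbase Qinstr l r [/pair_equal_spec[<- <-]|]; first exact: Qself.
case/(List.in_app_or (base_equations P)) => [/Qbase //|].
case/List.in_flat_map=> i [_]; case Pi: (List.nth_error P i) => [ins|] //.
exact: Qinstr.
Qed.

(** * Code and validity of the diagonal presentation *)

Lemma enc_presentation_cons sig e E :
  enc_presentation (sig, e :: E) =
  cpair (enc_list sig)
    (cpair (cpair (enc_term e.1) (enc_term e.2))
       (enc_list (map (fun e => cpair (enc_term e.1) (enc_term e.2)) E))).+1.
Proof. by []. Qed.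

Lemma enc_diagonal P :
  enc_presentation (diagonal P) =
  cpair (enc_list (sig_of P))
    (cpair (cpair (enc_term self) (enc_term (num (code P)))) (code P)).+1.
Proof. by rewrite /diagonal enc_presentation_cons. Qed.

Lemma enc_term_succ t :
  enc_term (succ t) = cpair 1 (cpair 1 (cpair (enc_term t) 0).+1).
Proof. by []. Qed.

Lemma cpairS0 a : cpair a.+1 0 = (cpair 0 a).+1.
Proof. rewrite /cpair !addn0 add0n; lia. Qed.

Lemma cpairnS a b : cpair a b.+1 = (cpair a.+1 b).+1.
Proof. by rewrite /cpair addnS addSn addnS. Qed.

Lemma cpair00 : cpair 0 0 = 0.
Proof. by []. Qed.

Arguments cpair : simpl never.

Lemma wf_iter_succ P okv n t :
  wf (sig_of P) okv (iter n succ t) = wf (sig_of P) okv t.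
Proof. by elim: n => //= n ->; rewrite andbT. Qed.

Lemma wf_num P okv n : wf (sig_of P) okv (num n).
Proof. by rewrite numE wf_iter_succ. Qed.

Lemma wf_exec P okv pc regs :
    wf (sig_of P) okv pc -> (forall r, wf (sig_of P) okv (regs r)) ->
  wf (sig_of P) okv (exec (nregs P) pc regs).
Proof.
move=> wf_pc wf_regs; have wf_all : all (wf (sig_of P) okv) (mkseq regs (nregs P)).
  by rewrite all_map; apply/allP=> r _; exact: wf_regs.
apply/and3P; split=> //.
  by apply/eqP; exact: (congr1 S (size_mkseq regs (nregs P))).
by apply/andP.
Qed.

Lemma wf_own_code P okv : wf (sig_of P) okv (own_code P).
Proof. by rewrite /= !wf_num. Qed.

Lemma diagonal_valid P : valid_presentation (diagonal P).
Proof.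
apply: diagonal_ind => [|l r|i ins l r _]; first by rewrite wf_num.
- move=> in_lr; do ![case: in_lr => [/pair_equal_spec[<- <-]|in_lr]] => //;
    rewrite ?wf_num //; split=> //.
  + by rewrite /= !wf_num.
  + by apply: wf_exec; rewrite ?wf_iter_succ.
  + apply/and3P; split=> //; apply/andP; split=> //.
    by apply: wf_exec => // -[|q] //; exact: wf_own_code.
- by case: ins => [q|q j] /= in_lr;
    do ![case: in_lr => [/pair_equal_spec[<- <-]|in_lr]] => //;
    split; apply: wf_exec; rewrite ?wf_num // => q'; case: ifP.
Qed.

(** * The standard model *)

(** The default 0 of [nth] fills the registers that [exec] does not carry, in agreement with the
    initial state of a run. *)
Definition standard (P : program) (f : nat) (a : seq nat) : nat :=
  match f, a with
  | 1, [:: x] => x.+1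
  | 2, [:: x; y] => cpair x y
  | 3, [:: x] => enc_term (num x)
  | 4, [:: x; y; z] => if x is 0 then y else z
  | 5, _ => code P
  | 6, pc :: regs => output P (pc, nth 0 regs)
  | _, _ => 0
  end.

Lemma eval_iter_succ P v n t :
  eval (standard P) v (iter n succ t) = n + eval (standard P) v t.
Proof. by elim: n => //= n ->. Qed.

Lemma eval_num P v n : eval (standard P) v (num n) = n.
Proof. by rewrite numE eval_iter_succ addn0. Qed.

Lemma eval_own_code P v :
  eval (standard P) v (own_code P) = enc_presentation (diagonal P).
Proof. by rewrite enc_diagonal /= !eval_num. Qed.

Lemma eval_exec P v pc regs :
  eval (standard P) v (exec (nregs P) pc regs) =
  output P (eval (standard P) v pc,
            fun r => if r < nregs P then eval (standard P) v (regs r) else 0).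
Proof.
transitivity (output P (eval (standard P) v pc,
    nth 0 (map (eval (standard P) v) (mkseq regs (nregs P))))) => //.
congr (output P (_, _)); apply: functional_extensionality => r.
rewrite -map_comp -/(mkseq _ _); case: ltnP => [lt_r|le_r].
  by rewrite nth_mkseq.
by rewrite nth_default // size_mkseq.
Qed.

Lemma step_some P i R ins : List.nth_error P i = Some ins ->
  step P (i, R) =
  match ins with
  | Inc r => Some (i.+1, upd R r (R r).+1)
  | Dec r j => if R r == 0 then Some (j, R) else Some (i.+1, upd R r (R r).-1)
  end.
Proof. by rewrite /step /= => ->. Qed.

(** The two sides evaluate to outputs of configurations one step apart, which agree by
    [output_step]. The bound [instr_reg_lt] places the touched register among the arguments of
    [exec]. *)
Lemma standard_instr P i ins l r v :
    List.nth_error P i = Some ins ->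
    List.In (l, r) (instr_equations (nregs P) i ins) ->
  eval (standard P) v l = eval (standard P) v r.
Proof.
move=> Pi; have lt_q := instr_reg_lt Pi; have stepE R := step_some R Pi.
case: ins lt_q stepE {Pi} => [q|q j] /= lt_q stepE in_lr;
  do ![case: in_lr => [/pair_equal_spec[<- <-]|in_lr]] => //; rewrite !eval_exec !eval_num.
- rewrite (output_step (stepE _)) lt_q; congr (output P (_, _)).
  apply: functional_extensionality => q'; rewrite /upd.
  by case: (q' =P q) => [->|_]; rewrite ?lt_q.
- set R := (X in output P (i, X)); have := stepE R.
  have -> : R q = 0 by rewrite /R lt_q eqxx.
  by move/output_step.
- set R := (X in output P (i, X)); have := stepE R.
  have -> : R q = (v q.+1).+1 by rewrite /R lt_q eqxx.
  move/output_step->; congr (output P (_, _)).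
  apply: functional_extensionality => q'; rewrite /upd /R.
  by case: (q' =P q) => [->|_]; rewrite ?lt_q.
Qed.

Lemma standard_sat P :
    output P (0, fun r => if r == 0 then enc_presentation (diagonal P) else 0)
      <> 0 ->
  forall l r v, List.In (l, r) (diagonal P).2 ->
    eval (standard P) v l = eval (standard P) v r.
Proof.
move=> out_neq0 l r v in_lr.
move: l r in_lr v; apply: diagonal_ind => [v|l r|i ins l r Pi in_lr v].
- by rewrite eval_num.
- move=> in_lr v; do ![case: in_lr => [/pair_equal_spec[<- <-]|in_lr]] => //.
  + exact: cpairS0.
  + exact: cpairnS.
  + by rewrite eval_num /= num0.
  + by rewrite /= !eval_num numS enc_term_succ.
  (* The counter is [size P + v 0], past the end of the program, so the machine has halted. *)
  + rewrite eval_exec eval_iter_succ output_halt // /step.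
    rewrite (List.nth_error_None P _).2 //; exact/leP/leq_addr.
  (* The only equation that depends on the answer of [P]: a nonzero output makes [sel] return its
     last argument. *)
  + rewrite [LHS]/= -/(eval (standard P) v (exec _ _ _)).
    rewrite -[output P _]/(eval (standard P) v
      (exec (nregs P) zero (fun q => if q == 0 then own_code P else zero))).
    rewrite eval_exec.
    set R := (X in output P X); set R0 := (X in output P X <> 0) in out_neq0.
    suff -> : R = R0 by case: (output P R0) out_neq0.
    congr (_, _); apply: functional_extensionality => q.
    by case: q => [|q]; rewrite ?eval_own_code //=; case: ifP.
- exact: standard_instr Pi in_lr.
Qed.

(** * Derivations *)

Notation wf1 P := (wf (sig_of P) (fun x => x < 1)).
Notation eqv1 P := (eqv (diagonal P) 1).

(** The default [zero] keeps the substitution well-formed at every variable, as [eqv_ax] demands. *)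
Lemma eqv_instance P ts l r :
    List.In (l, r) (diagonal P).2 -> all (wf1 P) ts ->
  eqv1 P (subst (nth zero ts) l) (subst (nth zero ts) r).
Proof.
move=> in_lr /(all_nthP zero) wf_ts; apply: eqv_ax => // x.
have [lt_x|le_x] := ltnP x (size ts); last by rewrite nth_default.
exact: wf_ts.
Qed.

Lemma in_base P l r : List.In (l, r) (base_equations P) ->
  List.In (l, r) (diagonal P).2.
Proof. by move=> in_lr; right; apply: (List.in_or_app (base_equations P)); left. Qed.

Lemma eqv_num P n : eqv1 P (num n) (num n).
Proof. by apply: eqv_refl; rewrite wf_num. Qed.

Lemma eqv_zero P : eqv1 P zero (num 0).
Proof. by rewrite num0; exact: eqv_refl. Qed.

Lemma eqv_succ P t u : eqv1 P t u -> eqv1 P (succ t) (succ u).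
Proof. by move=> tu; apply: eqv_app; do ![constructor=> //]. Qed.

Lemma eqv_pr P t t' u u' :
  eqv1 P t t' -> eqv1 P u u' -> eqv1 P (pr t u) (pr t' u').
Proof. by move=> tt' uu'; apply: eqv_app; do ![constructor=> //]. Qed.

Lemma eqv_exec P pc pc' regs regs' :
    eqv1 P pc pc' -> (forall r, eqv1 P (regs r) (regs' r)) ->
  eqv1 P (exec (nregs P) pc regs) (exec (nregs P) pc' regs').
Proof.
move=> pcpc' rr'; apply: eqv_app => //.
  exact: (congr1 S (size_mkseq regs (nregs P))).
by constructor=> //; rewrite /mkseq; elim: iota => //= *; constructor.
Qed.

Lemma subst_iter_succ s n t :
  subst s (iter n succ t) = iter n succ (subst s t).
Proof. by elim: n => //= n ->. Qed.

Lemma subst_num s n : subst s (num n) = num n.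
Proof. by rewrite numE subst_iter_succ. Qed.

Lemma subst_exec s K pc regs :
  subst s (exec K pc regs) = exec K (subst s pc) (fun r => subst s (regs r)).
Proof. by rewrite /exec /= /mkseq -map_comp. Qed.

(** Induction on the value [cpair a b]: each recursive equation of [pr] lowers it by one, while one
    of the two arguments may grow. *)
Lemma eqv_pr_num P a b : eqv1 P (pr (num a) (num b)) (num (cpair a b)).
Proof.
have prS t u : wf1 P t -> wf1 P u ->
    eqv1 P (pr t (succ u)) (succ (pr (succ t) u)).
  move=> wf_t wf_u; apply: (@eqv_instance P [:: t; u] (pr (Var 0) (succ (Var 1)))
    (succ (pr (succ (Var 0)) (Var 1)))); last by rewrite /= wf_t wf_u.
  by apply: in_base; do 2!right; left.
move Dn: (cpair a b) => n; elim: n a b Dn => [|n IH] [|a] [|b] Dn;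
  rewrite ?(cpair00, cpairS0, cpairnS) // in Dn *; rewrite ?num0 ?numS.
- by apply: (@eqv_instance P [::] (pr zero zero) zero) => //; apply: in_base; left.
- case: Dn => /IH/eqv_succ; rewrite numS; apply: eqv_trans.
  by have := prS zero (num b); rewrite num0; apply=> //; rewrite wf_num.
- case: Dn => /IH/eqv_succ; rewrite num0; apply: eqv_trans.
  apply: (@eqv_instance P [:: num a] (pr (succ (Var 0)) zero)
            (succ (pr zero (Var 0)))); last by rewrite /= wf_num.
  by apply: in_base; right; left.
- case: Dn => /IH/eqv_succ; rewrite !numS; apply: eqv_trans.
  by apply: prS; rewrite /= wf_num.
Qed.

Lemma eqv_pr_eval P t u a b :
  eqv1 P t (num a) -> eqv1 P u (num b) -> eqv1 P (pr t u) (num (cpair a b)).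
Proof. by move=> ta ub; apply: eqv_trans (eqv_pr_num P a b); apply: eqv_pr. Qed.

(** The [succ] equation of [quote] copies [enc_term_succ] with [pr] for [cpair], so the induction
    hypothesis and [eqv_pr_eval] evaluate it. *)
Lemma eqv_quote_num P n : eqv1 P (quote (num n)) (num (enc_term (num n))).
Proof.
elim: n => [|n IH]; first rewrite num0.
  have := @eqv_instance P [::] (quote zero) (num (enc_term zero)).
  by rewrite subst_num; apply=> //; apply: in_base; do 3!right; left.
rewrite [num n.+1]numS enc_term_succ; pose l := quote (succ (Var 0)).
pose r := pr (num 1) (pr (num 1) (succ (pr (quote (Var 0)) zero))).
apply: (@eqv_trans _ _ _ (subst (nth zero [:: num n]) r)).
  apply: (@eqv_instance P [:: num n] l); last by rewrite /= wf_num.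
  by apply: in_base; do 4!right; left.
rewrite /= !subst_num.
apply: eqv_pr_eval; first exact: eqv_num.
apply: eqv_pr_eval; first exact: eqv_num.
rewrite numS; apply: eqv_succ; apply: eqv_pr_eval => //.
exact: eqv_zero.
Qed.

(** Derivable counterpart of [eval_own_code]: congruence replaces [self] by its numeral also under
    [quote], which then computes the code of that numeral. *)
Lemma eqv_own_code P :
  eqv1 P (own_code P) (num (enc_presentation (diagonal P))).
Proof.
have self_code : eqv1 P self (num (code P)).
  have := @eqv_instance P [::] self (num (code P)).
  by rewrite subst_num; apply=> //; left.
rewrite enc_diagonal; apply: eqv_pr_eval; first exact: eqv_num.
rewrite numS; apply: eqv_succ; apply: eqv_pr_eval => //.
apply: eqv_pr_eval; first exact: eqv_num.
apply: eqv_trans (eqv_quote_num P _).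
by apply: eqv_app; do ![constructor=> //].
Qed.

(** * Simulation of runs by derivations *)

Definition config (P : program) (s : mstate) : term :=
  exec (nregs P) (num s.1) (fun r => num (s.2 r)).

Lemma eqv_step P s s' : step P s = Some s' -> eqv1 P (config P s) (config P s').
Proof.
case: s => i R; rewrite /step /=; case Pi: (List.nth_error P i) => [ins|] //.
(* The predecessor undoes the shift by which [Var r.+1] stands for register [r]. *)
have inst l r f : List.In (l, r) (instr_equations (nregs P) i ins) ->
    eqv1 P (subst (fun x => num (f x.-1)) l) (subst (fun x => num (f x.-1)) r).
  move=> in_lr; apply: eqv_ax => [|x]; last exact: wf_num.
  by right; exact: equations_instr Pi in_lr.
have execE pc f g : f =1 g -> exec (nregs P) pc f = exec (nregs P) pc g.
  by move=> fg; rewrite /exec /mkseq (eq_map fg).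
case: ins Pi inst => [q|q j] Pi inst.
- case=> <-; have := inst _ _ R (or_introl erefl).
  rewrite !subst_exec !subst_num; congr eqv; apply: execE => q' //=.
  by rewrite /upd; case: eqP => [->|] //; rewrite numS.
- case: eqP => [Rq0|/eqP Rq_neq0] [<-].
    have := inst _ _ R (or_introl erefl).
    rewrite !subst_exec !subst_num; congr eqv; apply: execE => q' /=;
      by case: eqP => [->|] //=; rewrite Rq0 num0.
  (* Here the variable of register [q] is its decremented contents, so the instance is taken at the
     registers after the step. *)
  have := inst _ _ (upd R q (R q).-1) (or_intror (or_introl erefl)).
  rewrite !subst_exec !subst_num; congr eqv; apply: execE => q' //=.
  case: eqP => [->|neq] /=; rewrite /upd ?eqxx; last by case: eqP.
  by rewrite -[LHS]/(succ (num (R q).-1)) -numS prednK // lt0n.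
Qed.

Lemma eqv_halt P s : step P s = None -> eqv1 P (config P s) (num (s.2 0)).
Proof.
case: s => i R; rewrite /step /=.
case Pi: (List.nth_error P i) => [ins|] //=; last move=> _.
  by case: ins {Pi} => // q j; case: ifP.
have /leP le_i := (List.nth_error_None P i).1 Pi.
(* [Var 0] receives the excess of the counter over the program length. *)
pose s x := if x is r.+1 then num (R r) else num (i - size P).
have wf_s x : wf1 P (s x) by case: x => [|r]; rewrite wf_num.
have in_halt : List.In (exec (nregs P) (iter (size P) succ (Var 0))
    (fun q => Var q.+1), Var 1) (diagonal P).2.
  by apply: in_base; do 7!right; left.
have := eqv_ax in_halt wf_s; rewrite subst_exec; congr eqv.
congr exec.
have -> : num i = iter (size P) succ (num (i - size P)).
  by rewrite !numE -iterD subnKC.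
by rewrite subst_iter_succ.
Qed.

Lemma eqv_run P k s s' :
  run P k s = Some s' -> eqv1 P (config P s) (num (s'.2 0)).
Proof.
elim: k s => [|k IH] s /=; case Ps: (step P s) => [s2|] //.
- by move=> [<-]; exact: eqv_halt.
- by move=> /IH; apply: eqv_trans; exact: eqv_step.
- by move=> [<-]; exact: eqv_halt.
Qed.

Lemma eqv_sel P t t' u v :
    eqv1 P t t' -> wf1 P u -> wf1 P v ->
  eqv1 P (sel t u v) (sel t' u v).
Proof.
move=> tt' wf_u wf_v; apply: eqv_app => //.
by do ![constructor=> //]; exact: eqv_refl.
Qed.

(** The chain is [t = sel zero t u = sel start t u = u]; simulating the run that answers 0 derives
    [start = zero]. *)
Lemma collapse P t u :
    computes P (enc_presentation (diagonal P)) 0 -> wf1 P t -> wf1 P u ->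
  eqv1 P t u.
Proof.
move=> [k [s [Prun s0]]] wf_t wf_u.
pose start := exec (nregs P) zero (fun q => if q == 0 then own_code P else zero).
have start0 : eqv1 P start zero.
  have := eqv_run Prun; rewrite s0 num0; apply: eqv_trans; apply: eqv_exec => [|r].
    exact: eqv_zero.
  by case: r => [|r]; [exact: eqv_own_code | exact: eqv_zero].
apply: (@eqv_trans _ _ _ (sel zero t u)).
  apply/eqv_sym/(@eqv_instance P [:: t; u] (sel zero (Var 0) (Var 1)) (Var 0)).
    by apply: in_base; do 5!right; left.
  by rewrite /= wf_t wf_u.
apply: (@eqv_trans _ _ _ (sel start t u)).
  by apply: eqv_sel => //; exact: eqv_sym.
have in_start : List.In (sel start (Var 0) (Var 1), Var 1) (diagonal P).2.
  by apply: in_base; do 8!right; left.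
have start_closed : subst (nth zero [:: t; u]) start = start.
  rewrite subst_exec /start /exec /mkseq; congr (App _ (_ :: _)).
  by apply: eq_map => q; case: (q == 0) => //=; rewrite !subst_num.
have := @eqv_instance P [:: t; u] _ _ in_start.
rewrite -[X in eqv _ _ (sel X t u)]start_closed; apply.
by rewrite /= wf_t wf_u.
Qed.

Theorem theorem4 : ~ decidable_presentation_problem affine.
Proof.
move=> [P decP]; have [y [comp [y1 y0]]] := decP _ (@diagonal_valid P).
(* If [T1] were trivial, [P] would answer 1, so the standard model would satisfy all equations and
   yet refute the derivable [zero = succ zero]. *)
have naff : ~ affine (diagonal P).
  move=> aff; have [t [_ eq_t]] := aff.
  have eq01 : eqv1 P zero (succ zero).
    by apply: eqv_trans (eq_t _ _); first apply/eqv_sym/eq_t.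
  rewrite (y1.2 aff) in comp.
  have sat := standard_sat (P := P); rewrite (outputP comp) in sat.
  by have := eqv_sound (sat (PeanoNat.Nat.neq_succ_0 0)) eq01 (fun=> 0).
(* Since [T1] is not trivial, [P] answers 0, and the resulting collapse makes [T1] trivial after
   all. *)
apply: (naff); exists (Var 0); split=> // u wf_u; apply: collapse => //.
by rewrite -(y0.2 naff).
Qed.
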